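(* Let $\mathcal{X}^1,\dots,\mathcal{X}^M$ be smooth complete Riemannian manifolds, let $p\ge1$, and let $\pi=e^{-f}\in\mathcal{P}_p(\times_{i=1}^M\mathcal{X}^i)$. Let $\mu_\star=\mu_\star^1\otimes\dots\otimes\mu_\star^M$ satisfy $\mu_\star^i=\mu_\star^i[\mu_\star^{-i}]$ and $\mu^i_\star\in\mathcal{P}_p(\mathcal{X}^i)$ for all $i$. Assume: (i) for all $i=1,\dots,M$, the optimality map $\mu_\star^i[\cdot]:\times_{j\ne i}\mathcal{P}(\mathcal{X}^j)\to\mathcal{P}(\mathcal{X}^i)$ is Fisher-smooth with constants $\{L_{ij}\}_{j\neq i}$ on $\times_{j\ne i}B_{\varepsilon_j}(\mu_\star^j)$; (ii) for all $i=1,\dots,M$, $\mu_\star^i$ satisfies a transportation-information inequality with constant $\lambda_i$. Define $R\in\mathbb{R}^{M\times M}$ by $R_{ij}=L_{ij}/\lambda_i$ for $i\ne j$ and $R_{ii}=0$. Suppose $\rho(R)<1$, let $\delta\in(0,\infty)^M$ satisfy $R\delta\prec\delta$, and let $c>0$ be such that $c\,\delta_i\le\varepsilon_i$ for all $i$. If $\mu_k^i\in B_{c\delta_i}(\mu_\star^i)$ for all $i=1,\dots,M$, then the parallel CAVI algorithm $\mu_{k+1}^i=\mu_\star^i[\mu_k^{-i}]$, $i=1,\dots,M$, satisfies $$W_{k+1,p}\preceq R\,W_{k,p}.$$ In particular, $\mu_{k+1}^i\in B_{c\delta_i}(\mu_\star^i)$ for all $i=1,\dots,M$, and the parallel CAVI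 algorithm converges exponentially fast to $\mu_\star$ in Wasserstein-$p$ distance with rate $\rho(R)$.
   Context: For a smooth complete Riemannian manifold $\mathcal{X}$ with geodesic distance $\mathsf{d}$ and volume measure $dx$, $\mathcal{P}(\mathcal{X})$ is the set of probability measures and $\mathcal{P}_p(\mathcal{X})$ the set of those absolutely continuous with respect to $dx$ with finite $p$-th moment. Measures are identified with their densities. $\mathbb{W}_p(\varrho_1,\varrho_2)=\inf_{\gamma}(\int \mathsf{d}(x_1,x_2)^p\,d\gamma)^{1/p}$ over couplings $\gamma$; $B_\varepsilon(\varrho)=\{\mu\in\mathcal{P}_p(\mathcal{X}):\mathbb{W}_p(\mu,\varrho)<\varepsilon\}$, $\varepsilon\in(0,\infty]$. Relative Fisher information: $\mathcal{I}(\varrho_1\|\varrho_2)=\int|\nabla\log\frac{d\varrho_1}{d\varrho_2}|^2\,d\varrho_1$ if $\varrho_1\ll\varrho_2$, and $+\infty$ otherwise. Optimality maps: for $\mu^{-i}=(\mu^j)_{j\ne i}$, $\mu_\star^i[\mu^{-i}](x_i)\propto\exp\left(-\mathbb{E}_{\bigotimes_{j\ne i}\mu^j}[f(X^{<i},x_i,X^{>i})]\right)$, where $X^{<i}=(X^1,\dots,X^{i-1})$ and $X^{>i}=(X^{i+1},\dots,X^M)$; it is the minimiser of $\mathrm{KL}(\cdot\,\|\pi)$ over the $i$-th factor with the others fixed. The maps are assumed to be well defined at the measures to which they are applied. Fisher-smoothness: $\mu_\star^i[\cdot]$ is Fisher-smooth with constants $\{L_{ij}\}_{j\ne i}$, $L_{ij}\ge0$,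 on $\times_{j\ne i}B_{\varepsilon_j}(\mu_\star^j)$ if $\mathcal{I}(\mu_\star^i[\mu^{-i}]\|\mu_\star^i[\mu_\star^{-i}])\le\left(\sum_{j\ne i}L_{ij}\mathbb{W}_p(\mu^j,\mu_\star^j)\right)^2$ for all $\mu^j\in B_{\varepsilon_j}(\mu_\star^j)$, $j\neq i$. Transportation-information inequality: $\gamma\in\mathcal{P}_p(\mathcal{X})$ satisfies it with constant $\lambda>0$ if $\lambda^2\,\mathbb{W}_p^2(\mu,\gamma)\le\mathcal{I}(\mu\|\gamma)$ for all $\mu\in\mathcal{P}(\mathcal{X})$ with $\mu\ll\gamma$. $\rho(\cdot)$ is the spectral radius; $\preceq$ and $\prec$ are entrywise inequalities ($\prec$ strict in every entry). When $\rho(R)<1$, a strictly positive vector $\delta$ with $R\delta\prec\delta$ exists. $W_{k,p}=(\mathbb{W}_p(\mu_k^1,\mu_\star^1),\dots,\mathbb{W}_p(\mu_k^M,\mu_\star^M))^\top$. ''Converges exponentially fast with rate $\rho(A)$'' means that $W_{k+m,p}\preceq A^mW_{k,p}$ for all $m\ge0$, so that $\limsup_{m\to\infty}\|W_{k+m,p}\|^{1/m}\le\rho(A)<1$ (here $A=R$). *)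

(* Defs.v *)
From HB Require Import structures.
From mathcomp Require Import all_boot all_order all_algebra.
From mathcomp Require Import all_classical all_reals all_analysis.
From mathcomp Require Import measurable_realfun complex.

Set Implicit Arguments.
Unset Strict Implicit.
Unset Printing Implicit Defensive.

Import Order.TTheory GRing.Theory Num.Theory.
Import numFieldNormedType.Exports.

Local Open Scope classical_set_scope.
Local Open Scope ring_scope.

Section product_space.
Context {I : finType} {d : I -> measure_display}.

Definition cylinders (T : forall i, measurableType (d i)) :
    set (set (forall i, T i)) :=
  [set C | exists i (A : set (T i)), measurable A /\ C = [set x | A (x i)]].

Arguments cylinders : clear implicits.

Definition prod_space (T : forall i, measurableType (d i)) :=
  g_sigma_algebraType (cylinders T).

Definition is_product_measure (R : realType)
    (T : forall i, measurableType (d i))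
    (mu : forall i, {measure set (T i) -> \bar R})
    (P : {measure set (prod_space T) -> \bar R}) : Prop :=
  forall A : (forall i, set (T i)), (forall i, measurable (A i)) ->
    P [set x | forall i, A i (x i)] = (\prod_i mu i (A i))%E.

(** For sigma-finite factors, the only case used, exactly one measure satisfies
    [is_product_measure]; the default [mzero] is then irrelevant. *)
Definition product_measure (R : realType) (T : forall i, measurableType (d i))
    (mu : forall i, {measure set (T i) -> \bar R}) :
    {measure set (prod_space T) -> \bar R} :=
  if pselect (exists P, is_product_measure mu P) is left e
  then projT1 (cid e) else mzero.

End product_space.

Section euclidean.
Context {R : realType}.

(** Lebesgue measure on R^n lives on functions ['I_n -> R]; [rV_of] reads such
    a function as a row vector, the type on which derivatives are taken. *)
Definition coord_space n :=
  prod_space (fun _ : 'I_n => measurableTypeR R : measurableType _).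

Definition lebesgue_n n : {measure set (coord_space n) -> \bar R} :=
  product_measure (fun _ : 'I_n => @lebesgue_measure R).

Definition rV_of {n} (x : coord_space n) : 'rV[R]_n := \row_i x i.

Definition partials n (W : normedModType R) (f : 'rV[R]_n -> W)
    (s : seq 'I_n) : 'rV[R]_n -> W :=
  foldr (fun k g => fun x => 'D_(delta_mx 0 k) g x) f s.

(** For open [U], this is equivalent to [f] being C^infinity on [U]. *)
Definition smooth_on n (W : normedModType R) (U : set 'rV[R]_n)
    (f : 'rV[R]_n -> W) : Prop :=
  forall (s : seq 'I_n) x, U x ->
    {for x, continuous (partials f s)} /\
    forall k, derivable (partials f s) x (delta_mx 0 k).

Definition test_function n (V : set 'rV[R]_n) (psi : 'rV[R]_n -> R) : Prop :=
  smooth_on setT (psi : 'rV[R]_n -> R^o) /\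
  exists K : set 'rV[R]_n,
    [/\ compact K, K `<=` V & forall v, ~ K v -> psi v = 0].

Definition locally_integrable n (V : set 'rV[R]_n) (u : 'rV[R]_n -> R) : Prop :=
  forall K : set 'rV[R]_n, compact K -> K `<=` V ->
    (lebesgue_n n).-integrable (rV_of @^-1` K) (fun x => (u (rV_of x))%:E).

(** [w] is the distributional gradient of [u] on the open set [V]. *)
Definition weak_gradient n (V : set 'rV[R]_n) (u : 'rV[R]_n -> R)
    (w : 'rV[R]_n -> 'rV[R]_n) : Prop :=
  locally_integrable V u /\
  forall k : 'I_n, locally_integrable V (fun v => w v 0 k) /\
    forall psi, test_function V psi ->
      (\int[lebesgue_n n]_(x in rV_of @^-1` V)
          (u (rV_of x) * 'D_(delta_mx 0 k) (psi : 'rV[R]_n -> R^o) (rV_of x))%:E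
       = - \int[lebesgue_n n]_(x in rV_of @^-1` V)
            (w (rV_of x) 0 k * psi (rV_of x))%:E)%E.

End euclidean.
Arguments lebesgue_n {R} n.

Definition borel (T : ptopologicalType) := g_sigma_algebraType (@open T).

(** A smooth manifold with an atlas indexed by [chart], a Riemannian metric
    given by its matrix in the coordinates of each chart (tangent vectors are
    row vectors of coordinates), and its volume measure, which the last
    field determines.  [phi c] and [phi_inv c] are meaningful only on [dom c]
    and on [phi c @` dom c]. *)
Record riemannianManifold (R : realType) := RiemannianManifold {
  carrier :> ptopologicalType ;
  dim : nat ;
  chart : Type ;
  dom : chart -> set carrier ;
  phi : chart -> carrier -> 'rV[R]_dim ;
  phi_inv : chart -> 'rV[R]_dim -> carrier ;
  metric : chart -> 'rV[R]_dim -> 'M[R]_dim ;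
  vol : {measure set (borel carrier) -> \bar R} ;
  _ : hausdorff_space carrier ;
  _ : @second_countable carrier ;
  _ : forall x, exists c, dom c x ;
  _ : forall c, open (dom c) ;
  _ : forall c, open (phi c @` dom c) ;
  _ : forall c x, dom c x -> phi_inv c (phi c x) = x ;
  _ : forall c x, dom c x -> {for x, continuous (phi c)} ;
  _ : forall c x, dom c x -> {for phi c x, continuous (phi_inv c)} ;
  _ : forall c c',
        smooth_on (phi c @` (dom c `&` dom c')) (phi c' \o phi_inv c) ;
  _ : forall c, smooth_on (phi c @` dom c) (metric c) ;
  _ : forall c x, dom c x -> (metric c (phi c x))^T = metric c (phi c x) ;
  _ : forall c x (v : 'rV[R]_dim), dom c x -> v != 0 ->
        0 < (v *m metric c (phi c x) *m v^T) 0 0 ;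
  (* change of coordinates, with J the Jacobian matrix of the transition map *)
  _ : forall c c' x, dom c x -> dom c' x ->
        let J := \matrix_(i, j)
          ('D_(delta_mx 0 i) (phi c' \o phi_inv c) (phi c x)) 0 j in
        metric c (phi c x) = J *m metric c' (phi c' x) *m J^T ;
  _ : forall c (A : set (borel carrier)), measurable A -> A `<=` dom c ->
        (vol A = \int[lebesgue_n dim]_(x in rV_of @^-1` (phi c @` A))
                   (Num.sqrt (\det (metric c (rV_of x))))%:E)%E
}.

Section riemannian.
Context {R : realType}.
Implicit Types X : riemannianManifold R.

(** [gamma] is C^1 on [0, 1] (up to the end points, as the restriction of a
    curve defined on a neighbourhood) with Riemannian speed [speed]; by
    compatibility of the charts, the choice of [c] is immaterial. *)
Definition C1_curve X (gamma : R -> X) (speed : R -> R) : Prop :=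
  forall t, t \in `[0, 1] ->
    {for t, continuous gamma} /\
    exists c : chart X,
      let q := phi c \o gamma in
      [/\ dom c (gamma t),
          \forall s \near t, derivable q s 1,
          {for t, continuous (derive1 q)} &
          speed t = Num.sqrt
            ((derive1 q t *m metric c (q t) *m (derive1 q t)^T) 0 0)].

Inductive piecewise_C1_length X : X -> X -> \bar R -> Prop :=
| pw_nil x : piecewise_C1_length x x 0%E
| pw_cons gamma speed y l : C1_curve gamma speed ->
    piecewise_C1_length (gamma 1) y l ->
    piecewise_C1_length (gamma 0) y
      (\int[lebesgue_measure]_(t in `[0%R, 1%R]) (speed t)%:E + l)%E.

(** Manifolds are not required to be connected: the geodesic distance is [+oo]
    between distinct components. *)
Definition dist X (x y : X) : \bar R :=
  ereal_inf [set l | piecewise_C1_length x y l].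

Definition complete_manifold X : Prop :=
  forall u : nat -> X,
    (forall e : R, 0 < e -> exists N, forall m n, (N <= m)%N -> (N <= n)%N ->
       (dist (u m) (u n) < e%:E)%E) ->
    exists x : X, (fun n => dist (u n) x) @ \oo --> 0%E.

Local Open Scope ereal_scope.

(** On a connected manifold the choice of the base point [x0] is immaterial. *)
Definition Pp d (T : measurableType d) (vol : {measure set T -> \bar R})
    (dist : T -> T -> \bar R) (p : R) (mu : probability T R) : Prop :=
  mu `<< vol /\ exists x0, \int[mu]_x (dist x0 x `^ p) < +oo.

Definition Pp_manifold X p (mu : probability (borel X) R) : Prop :=
  Pp (@vol _ X) (@dist X) p mu.

Definition coupling X (mu nu : probability (borel X) R)
    (g : probability (borel X * borel X)%type R) : Prop :=
  forall A : set (borel X), measurable A ->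
    g (A `*` setT) = mu A /\ g (setT `*` A) = nu A.

Definition wasserstein X (p : R) (mu nu : probability (borel X) R) : \bar R :=
  (ereal_inf [set \int[g]_z (dist (z.1 : X) (z.2 : X) `^ p) |
              g in coupling mu nu]) `^ p^-1.

Definition wball X (p : R) (eps : \bar R) (rho mu : probability (borel X) R)
    : Prop :=
  Pp_manifold p mu /\ wasserstein p mu rho < eps.

Definition trunc_log (N : nat) (h : \bar R) : R :=
  fine (maxe (- N%:R%:E) (mine N%:R%:E (lne h))).

(** [s] is the squared Riemannian norm of the weak gradient of [log h].  As
    [log h] may be infinite or fail to be locally integrable, the gradient is
    the field [w] such that, for all N, the truncation of [log h] to [-N, N]
    has distributional gradient [w] on [|log h| < N] and 0 elsewhere; this is
    the ordinary weak (or classical) gradient when the latter exists.  In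
    coordinates [w] is a covector, hence the inverse metric. *)
Definition sqnorm_grad_log X (h : borel X -> \bar R) (s : borel X -> R) : Prop :=
  forall c : chart X, exists w : 'rV[R]_(dim X) -> 'rV[R]_(dim X),
    (forall N : nat,
       weak_gradient (phi c @` dom c)
         (fun v => trunc_log N (h (phi_inv c v)))
         (fun v => if - N%:R%:E < lne (h (phi_inv c v)) < N%:R%:E
                   then w v else 0%R)) /\
    forall x : X, dom c x ->
      s x = (w (phi c x) *m invmx (metric c (phi c x)) *m (w (phi c x))^T)%R
              ord0 ord0.

(** [h] is a version of the density of [rho1] with respect to [rho2].  When
    [rho2] is absolutely continuous with respect to the volume, the integral
    does not depend on the admissible pair [(h, s)], so that the infimum only
    serves to give the value [+oo] when no version of the density is weakly
    differentiable. *)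
Definition fisher_info X (rho1 rho2 : probability (borel X) R) : \bar R :=
  if pselect (rho1 `<< rho2) then
    ereal_inf [set \int[rho1]_x (s x)%:E | s in
      [set s : borel X -> R | measurable_fun setT s /\
         exists h : borel X -> \bar R,
           [/\ measurable_fun setT h,
               forall x, 0 <= h x,
               forall A, measurable A -> rho1 A = \int[rho2]_(x in A) h x &
               sqnorm_grad_log h s]]]
  else +oo.

Definition transport_information X (p lambda : R)
    (g : probability (borel X) R) : Prop :=
  [/\ (0 < lambda)%R, Pp_manifold p g &
  forall mu : probability (borel X) R, mu `<< g ->
    (lambda ^+ 2)%:E * wasserstein p mu g ^+ 2 <= fisher_info mu g].

End riemannian.

Section cavi.
Context {R : realType} {M : nat}.
Variable X : 'I_M -> riemannianManifold R.

Local Open Scope ereal_scope.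

Definition Xprod := prod_space (fun i => borel (X i) : measurableType _).

Definition Xothers (i : 'I_M) :=
  prod_space (fun j : {j : 'I_M | j != i} =>
                borel (X (val j)) : measurableType _).

Definition vol_prod : {measure set Xprod -> \bar R} :=
  product_measure (fun i => @vol _ (X i)).

(** The geodesic distance of the product Riemannian metric is the l^2
    combination of the geodesic distances; likewise [vol_prod] is its volume. *)
Definition dist_prod (x y : Xprod) : \bar R :=
  (\sum_i dist (x i : X i) (y i : X i) ^+ 2) `^ 2^-1.

Definition prob_family := forall i, probability (borel (X i)) R.

(** The point (X^{<i}, x_i, X^{>i}). *)
Definition insert (i : 'I_M) (xi : X i) (y : Xothers i) : Xprod :=
  fun j => match boolP (j == i) with
           | AltTrue h => ecast k (X k) (esym (eqP h)) xi
           | AltFalse h => y (exist _ j h)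
           end.

Definition prod_others (i : 'I_M) (mu : prob_family) :
    {measure set (Xothers i) -> \bar R} :=
  product_measure (fun j : {j : 'I_M | j != i} =>
    mu (val j) : {measure set (borel (X (val j))) -> \bar R}).

Definition mean_potential (f : Xprod -> R) (i : 'I_M) (mu : prob_family)
    (xi : X i) : \bar R :=
  \int[prod_others i mu]_y (f (insert xi y))%:E.

Definition opt_weight (f : Xprod -> R) (i : 'I_M) (mu : prob_family)
    (xi : borel (X i)) : \bar R :=
  expeR (- mean_potential f mu (xi : X i)).

(** [nu] is the value of the i-th optimality map at [(mu j)_{j != i}]: the map
    is well defined there (the expectation makes sense in [\bar R] for almost
    every x_i and the weight can be normalised), and [nu] has the normalised
    weight as its density.  The i-th component of [mu] is not used. *)
Definition is_optimality_map (f : Xprod -> R) (i : 'I_M) (mu : prob_family)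
    (nu : probability (borel (X i)) R) : Prop :=
  let Z := \int[@vol _ (X i)]_x opt_weight f mu x in
  [/\ {ae @vol _ (X i), forall x : borel (X i),
        let F := fun y => (f (insert (x : X i) y))%:E in
        \int[prod_others i mu]_y F^\+ y < +oo \/
        \int[prod_others i mu]_y F^\- y < +oo},
      0 < Z < +oo &
      forall A, measurable A ->
        nu A = (fine Z)^-1%:E * \int[@vol _ (X i)]_(x in A) opt_weight f mu x].

(** The inequality is required at the measures where the i-th map is defined. *)
Definition fisher_smooth (p : R) (f : Xprod -> R) (mustar : prob_family)
    (eps : 'I_M -> \bar R) (L : 'I_M -> 'I_M -> R) (i : 'I_M) : Prop :=
  (forall j, j != i -> (0 <= L i j)%R) /\
  forall mu : prob_family,
    (forall j, j != i -> wball p (eps j) (mustar j) (mu j)) ->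
    forall nu nustar : probability (borel (X i)) R,
      is_optimality_map f mu nu -> is_optimality_map f mustar nustar ->
      fisher_info nu nustar <=
        (\sum_(j | j != i) (L i j)%:E * wasserstein p (mu j) (mustar j)) ^+ 2.

Definition cavi_step (f : Xprod -> R) (mu mu' : prob_family) : Prop :=
  forall i, is_optimality_map f mu (mu' i).

End cavi.

Definition spectral_radius (R : realType) n (A : 'M[R]_n) : R :=
  sup [set ComplexField.Normc.normc z |
       z in [set z : R[i] | eigenvalue (map_mx (fun x : R => x%:C%C) A) z]].

(* Main.v *)
(* The Fisher information of the updated factor relative to its target is finite
   by Fisher-smoothness, so the updated factor is absolutely continuous with
   respect to the target and the transportation-information inequality applies:
   taking square roots gives [W_{k+1} <= R W_k].  Weighting by [delta] keeps the
   iterates in the balls; that they keep finite [p]-th moments follows from the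
   triangle inequality for the geodesic distance, integrated against a coupling.
   The distance to a fixed point is measurable because short segments in charts
   are short curves; the distance as a function of two points is not shown to be
   measurable, so integrals of it are handled as suprema over simple functions.
   For the rate, the powers of a matrix are [O(r^m)] for every [r] above its
   spectral radius: by Cayley-Hamilton they satisfy a linear recurrence whose
   characteristic roots are the eigenvalues, and factors can be removed one at a
   time. *)
Require Import Defs.
From HB Require Import structures.
From mathcomp Require Import all_boot all_order all_algebra.
From mathcomp Require Import all_classical all_reals all_analysis.
From mathcomp Require Import measurable_realfun complex.
From mathcomp Require Import lra.

Set Implicit Arguments.
Unset Strict Implicit.
Unset Printing Implicit Defensive.

Import Order.TTheory GRing.Theory Num.Theory.
Import numFieldNormedType.Exports.

Local Open Scope classical_set_scope.
Local Open Scope ring_scope.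

(** * Powers of a matrix and its spectral radius *)

Section gelfand.
Context {R : realType}.
Local Notation C := R[i].

Lemma normc_normr (x : R) : ComplexField.Normc.normc x%:C%C = `|x|.
Proof. by rewrite /= expr0n/= addr0 sqrtr_sqr. Qed.

(** Solves one first-order factor of a linear recurrence. Because the modulus of [z] is strictly
    below [r], a forcing term of order [r ^+ m] produces no polynomial factor in [m], even at a
    repeated root. *)
Lemma recurrence_geometric_bound (z : C) (r K : R) (a b : nat -> C) :
  ComplexField.Normc.normc z < r ->
  (forall m, a m.+1 = z * a m + b m) ->
  (forall m, ComplexField.Normc.normc (b m) <= K * r ^+ m) ->
  exists K', forall m, ComplexField.Normc.normc (a m) <= K' * r ^+ m.
Proof.
move=> zr ab bK.
have z0 : 0 <= ComplexField.Normc.normc z by case: (z) => x y; exact: sqrtr_ge0.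
have r0 : 0 < r by exact: le_lt_trans zr.
set d := r - ComplexField.Normc.normc z.
have d0 : 0 < d by rewrite /d subr_gt0.
(* The first term of the maximum starts the induction; the second gives [K <= d * K'], so the
   forcing term fits in the gap between [r] and the modulus of [z]. *)
exists (Num.max (ComplexField.Normc.normc (a 0%N)) (K / d)).
set K' := Num.max _ _.
have KK' : K <= d * K'.
  by rewrite mulrC -ler_pdivrMr// /K' le_max lexx orbT.
elim=> [|m IH]; first by rewrite expr0 mulr1 /K' le_max lexx.
rewrite ab (le_trans (le_normcD _ _))// ComplexField.Normc.normcM.
apply: (@le_trans _ _
    (ComplexField.Normc.normc z * (K' * r ^+ m) + K * r ^+ m)).
  by rewrite lerD// ler_wpM2l.
rewrite mulrA -mulrDl exprS mulrA ler_wpM2r ?(exprn_ge0 _ (ltW r0))//.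
have -> : K' * r = ComplexField.Normc.normc z * K' + d * K'.
  by rewrite /d mulrBl [r * _]mulrC addrC subrK.
by rewrite lerD2l.
Qed.

(** Induction on [s], with [B] general so that it can absorb the factor being removed:
    [A ^+ m.+1 * B] equals [z *: (A ^+ m * B)] plus [A ^+ m * (B * (A - z%:M))], and the induction
    hypothesis bounds the last term. When [s] is empty, [B] is 0. *)
Lemma mxpow_geometric_bound n (A : 'M[C]_n.+1) (s : seq C) (r : R)
    (B : 'M[C]_n.+1) :
  (forall z, z \in s -> ComplexField.Normc.normc z < r) ->
  B * \prod_(z <- s) (A - z%:M) = 0 -> GRing.comm A B ->
  forall i j, exists K, forall m,
    ComplexField.Normc.normc ((A ^+ m * B) i j) <= K * r ^+ m.
Proof.
elim: s B => [|z s IH] B sr.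
  rewrite big_nil mulr1 => -> _ i j; exists 0 => m.
  by rewrite mulr0 mxE mul0r ComplexField.Normc.normc0.
rewrite big_cons mulrA => B0 AB i j.
have AzB : GRing.comm A (B * (A - z%:M)).
  apply: commrM => //; apply: commrB => //; exact: comm_mx_scalar.
have sr' y : y \in s -> ComplexField.Normc.normc y < r.
  by move=> ys; apply: sr; rewrite in_cons ys orbT.
have [K HK] := IH _ sr' B0 AzB i j.
apply: (@recurrence_geometric_bound z r K _
  (fun m => (A ^+ m * (B * (A - z%:M))) i j)) => //.
  by apply: sr; rewrite mem_head.
move=> m.
have -> : A ^+ m.+1 * B =
    z *: (A ^+ m * B) + A ^+ m * (B * (A - z%:M)).
  rewrite exprSr -mulrA AB mulrBr -[B * z%:M]/(B *m z%:M) mul_mx_scalar.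
  by rewrite mulrBr -scalerAr addrC subrK.
by rewrite !mxE.
Qed.

Lemma spectral_radius_ge n (A : 'M[R]_n) (z : C) :
  eigenvalue (map_mx (fun x : R => x%:C%C) A) z ->
  ComplexField.Normc.normc z <= spectral_radius A.
Proof.
move=> Az; apply: ub_le_sup; last by exists z.
set B := map_mx _ A.
have [s hs] := closed_field_poly_normal (char_poly B).
(* A supremum dominates its elements only when the set is bounded; the sum of the moduli of all
   characteristic roots is an upper bound. *)
exists (\sum_(y <- s) ComplexField.Normc.normc y) => _ [y/= yB <-].
have normc_ge0 (x : C) : 0 <= ComplexField.Normc.normc x.
  by case: x => a b; exact: sqrtr_ge0.
have ys : y \in s.
  move: yB; rewrite eigenvalue_root_char hs rootZ ?root_prod_XsubC//.
  by rewrite (monicP (char_poly_monic B)) oner_eq0.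
by rewrite (big_rem y)//= lerDl sumr_ge0.
Qed.

Lemma mxpow_spectral_bound n (A : 'M[R]_n) (r : R) :
  spectral_radius A < r ->
  exists2 K, 0 <= K & forall m i j, `|(A ^+ m) i j| <= K * r ^+ m.
Proof.
case: n A => [|n] A Ar; first by exists 0 => // m [].
set B := map_mx (fun x : R => x%:C%C) A.
have [s hs] := closed_field_poly_normal (char_poly B).
have {}hs : char_poly B = \prod_(z <- s) ('X - z%:P).
  by rewrite hs (monicP (char_poly_monic B)) scale1r.
have sr z : z \in s -> ComplexField.Normc.normc z < r.
  move=> zs; apply: le_lt_trans Ar; apply: spectral_radius_ge.
  by rewrite eigenvalue_root_char hs root_prod_XsubC.
have B0 : 1 * \prod_(z <- s) (B - z%:M) = 0.
  rewrite mul1r -(Cayley_Hamilton B) hs rmorph_prod; apply: eq_bigr => z _.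
  by rewrite rmorphB/= horner_mx_X horner_mx_C.
have HK := mxpow_geometric_bound sr B0 (commr1 B).
(* The characteristic polynomial has positive degree, hence a root, whose modulus lies below [r]. *)
have r0 : 0 <= r.
  have : size s = n.+1.
    by have := size_char_poly B; rewrite hs size_prod_XsubC => -[].
  case: s {hs B0 HK} sr => // z s /(_ z (mem_head _ _)) zr _; apply/ltW.
  by apply: le_lt_trans zr; case: z => a b; exact: sqrtr_ge0.
have {}HK (ij : 'I_n.+1 * 'I_n.+1) : {K | forall m,
    `|(A ^+ m) ij.1 ij.2| <= K * r ^+ m}.
  apply: cid; have [K HK'] := HK ij.1 ij.2; exists K => m.
  have := HK' m; rewrite mulr1 /B -(rmorphXn (map_mx (real_complex R))).
  by rewrite mxE normc_normr.
(* Adding the constants of all entries gives one that serves every entry. *)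
exists (\sum_ij `|sval (HK ij)|); first by rewrite sumr_ge0.
move=> m i j; apply: (le_trans (svalP (HK (i, j)) m)).
rewrite ler_wpM2r ?exprn_ge0// (bigD1 (i, j))//= (le_trans (ler_norm _))//.
by rewrite lerDl sumr_ge0.
Qed.

End gelfand.

(** * Lower integrals *)

Section lower_integral.
Local Open Scope ereal_scope.
Context {R : realType}.

Import HBNNSimple.

(** The integral of a nonnegative function is a supremum over the simple functions below it, and a
    larger function has more of them, measurable or not. *)
Lemma ge0_le_integral_nonmeasurable d (T : measurableType d)
    (mu : {measure set T -> \bar R}) (D : set T) (f g : T -> \bar R) :
  (forall x, D x -> 0 <= f x) -> (forall x, D x -> f x <= g x) ->
  \int[mu]_(x in D) f x <= \int[mu]_(x in D) g x.
Proof.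
move=> f0 fg.
have g0 x : D x -> 0 <= g x by move=> Dx; exact: le_trans (f0 _ Dx) (fg _ Dx).
rewrite !ge0_integralE//; apply: ge_ereal_sup => _ [h/= hf <-].
apply: ereal_sup_ubound; exists h => //= x; apply: (le_trans (hf x)).
exact: lee_restrict.
Qed.

(** A simple function below [f] pulls back to one below [f \o phi]. Without measurability of [f] the
    converse may fail, as a simple function below [f \o phi] need not factor through [phi]. *)
Lemma ge0_le_integral_pushforward d1 d2 (T1 : measurableType d1)
    (T2 : measurableType d2) (phi : T1 -> T2) (mu : {measure set T1 -> \bar R})
    (nu : {measure set T2 -> \bar R}) (f : T2 -> \bar R) :
  measurable_fun setT phi -> (forall x, 0 <= f x) ->
  (forall A, measurable A -> nu A = mu (phi @^-1` A)) ->
  \int[nu]_y f y <= \int[mu]_x f (phi x).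
Proof.
move=> mphi f0 numu.
rewrite ge0_integralTE//; apply: ge_ereal_sup => _ [h/= hf <-].
rewrite -integralT_nnsfun.
rewrite (eq_measure_integral (pushforward mu phi)); last first.
  by move=> A mA _; exact: numu.
rewrite ge0_integral_pushforward//=; last first.
- by move=> y _; rewrite lee_fin.
- exact/measurable_EFinP.
by rewrite preimage_setT; apply: ge0_le_integral_nonmeasurable => // x _;
  rewrite lee_fin.
Qed.

(* A simple function [h] below [f + g] splits as [h <= f + (h - f)^+], with
   [(h - f)^+ <= g]; hence [g] need not be measurable. *)
Lemma ge0_integralD_le d (T : measurableType d)
    (mu : {measure set T -> \bar R}) (f g : T -> \bar R) :
  measurable_fun setT f -> (forall x, 0 <= f x) -> (forall x, 0 <= g x) ->
  \int[mu]_x (f x + g x) <= \int[mu]_x f x + \int[mu]_x g x.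
Proof.
move=> mf f0 g0.
rewrite [leLHS]ge0_integralTE; last by move=> x; rewrite adde_ge0.
apply: ge_ereal_sup => _ [h/= hfg <-]; rewrite -integralT_nnsfun.
pose k x := maxe 0 ((h x)%:E - f x).
have k0 x : 0 <= k x by rewrite /k le_max lexx.
have mh : measurable_fun setT (EFin \o h) by exact/measurable_EFinP.
have mk : measurable_fun setT k.
  apply: measurable_maxe; first exact: measurable_cst.
  exact: emeasurable_funB.
apply: (@le_trans _ _ (\int[mu]_x (f x + k x))).
  apply: ge0_le_integral_nonmeasurable => x _; first by rewrite lee_fin.
  move: (k0 x); rewrite /k; case: (f x) (f0 x) => [r| |] // _ kx0; last first.
    by rewrite addye ?leey// -ltNye (lt_le_trans _ kx0).
  rewrite -leeBlDl// le_max; apply/orP; right.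
  by rewrite lexx.
rewrite ge0_integralD//; apply: leeD2l.
apply: ge0_le_integral_nonmeasurable => x _ //.
rewrite /k ge_max g0/=; move: (hfg x) (f0 x) (g0 x).
case: (f x) => [r| |]; case: (g x) => [s| |] //; rewrite ?leey//.
by move=> + _ _; rewrite -EFinD -EFinB !lee_fin lerBlDl.
by rewrite leNye.
Qed.

(** The image measure gives half-open intervals their length, which characterises Lebesgue
    measure. *)
Lemma lebesgue_measure_reflection (a : R) (A : set (measurableTypeR R)) :
  measurable A ->
  lebesgue_measure A = lebesgue_measure ((fun t => a - t)%R @^-1` A).
Proof.
pose phi (t : measurableTypeR R) : measurableTypeR R := (a - t)%R.
have mphi : measurable_fun setT phi.
  by apply: measurable_funB; [exact: measurable_cst|exact: measurable_id].
pose m := pushforward (@lebesgue_measure R) phi.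
move=> mA; rewrite (@lebesgue_measure_unique R m)//.
move=> _ [[b c]/= _ <-]; rewrite /m /pushforward/=.
have -> : phi @^-1` [set` `]b, c]] = [set` `[(a - c)%R, (a - b)%R[].
  apply/seteqP; split => t /=; rewrite /phi !in_itv/= => /andP[? ?];
    by apply/andP; split; lra.
rewrite !lebesgue_measure_itv/= !lte_fin.
have -> : (a - c < a - b = (b < c))%R by apply/idP/idP => ?; lra.
by case: ifP => // _; rewrite -!EFinB; congr EFin; lra.
Qed.

Lemma ge0_integral_reflection_le (s : R -> \bar R) :
  (forall t, t \in `[0%R, 1%R] -> 0 <= s t) ->
  \int[lebesgue_measure]_(t in `[0%R, 1%R]) s (1 - t)%R <=
  \int[lebesgue_measure]_(t in `[0%R, 1%R]) s t.
Proof.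
move=> s0; rewrite integral_mkcond [leRHS]integral_mkcond.
have -> : (fun t => s (1 - t)%R) \_ `[0%R, 1%R] =
    (fun t => (s \_ `[0%R, 1%R]) (1 - t)%R).
  apply/funext => t; rewrite /patch.
  have -> : ((1 - t)%R \in `[0%R, 1%R]%classic) = (t \in `[0%R, 1%R]%classic).
    apply/idP/idP; rewrite !inE/= !in_itv/= => /andP[? ?];
      by apply/andP; split; lra.
  by [].
have := @ge0_le_integral_pushforward _ _ (measurableTypeR R) (measurableTypeR R)
  (fun t => 1 - t)%R lebesgue_measure lebesgue_measure
  (fun t => (s \_ `[0%R, 1%R]) (1 - t)%R).
(* The pushforward inequality is applied to the reflected function, so that the second reflection
   restores [s] on the right. *)
under [X in _ -> _ -> _ -> _ <= X]eq_integral do rewrite opprB addrC subrK.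
apply.
- by apply: measurable_funB; [exact: measurable_cst|exact: measurable_id].
- by move=> t; exact: erestrict_ge0.
- by move=> A mA; exact: lebesgue_measure_reflection.
Qed.

End lower_integral.

(** * Curves and the geodesic distance *)

Section derive_reflection.
Context {R : realType}.

Lemma is_derive_onem (s : R) : is_derive s (1 : R) (fun s : R => 1 - s) (-1).
Proof.
have -> : (fun s : R => 1 - s) = (cst 1 : R -> R) - (id : R -> R) by [].
by apply: is_derive_eq; rewrite ?sub0r.
Qed.

Lemma derive1_reflection (V : normedModType R) (q : R -> V) (s : R) :
  derivable q (1 - s) 1 ->
  derivable (fun s : R => q (1 - s)) s 1 /\
  derive1 (fun s : R => q (1 - s)) s = - derive1 q (1 - s).
Proof.
move=> /derivable1_diffP dqs.
have drev : differentiable (fun s : R => 1 - s) s.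
  by apply/derivable1_diffP; have [] := is_derive_onem s.
have dq : differentiable (q \o (fun s : R => 1 - s)) s.
  exact: differentiable_comp.
split; first by apply/derivable1_diffP.
rewrite derive1E'//.
rewrite diff_comp//=.
rewrite -derive1E'//.
rewrite derive1E (@derive_val _ _ _ _ _ _ _ (is_derive_onem s)).
rewrite linearN derive1E'; by [].
Qed.

End derive_reflection.

Section curves.
Context {R : realType} {X : riemannianManifold R}.

Lemma phiK (c : chart X) x : dom c x -> phi_inv c (phi c x) = x.
Proof. by case: X c x => /= *; auto. Qed.

Lemma open_dom (c : chart X) : open (dom c).
Proof. by case: X c => /= *; auto. Qed.

Lemma open_image_dom (c : chart X) : open (phi c @` dom c).
Proof. by case: X c => /= *; auto. Qed.

Lemma phi_continuous (c : chart X) x : dom c x -> {for x, continuous (phi c)}.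
Proof. by case: X c x => /= *; auto. Qed.

Lemma phi_inv_continuous (c : chart X) x : dom c x ->
  {for phi c x, continuous (phi_inv c)}.
Proof. by case: X c x => /= *; auto. Qed.

Lemma chart_at (x : X) : exists c : chart X, dom c x.
Proof. by case: X x => /= *; auto. Qed.

Lemma metric_continuous (c : chart X) x : dom c x ->
  {for phi c x, continuous (metric c)}.
Proof.
move=> cx; have : smooth_on (phi c @` dom c) (metric c).
  by case: X c x cx => /= *; auto.
by move=> /(_ [::] (phi c x) (imageP _ cx)) [].
Qed.

Lemma C1_speed_ge0 (gamma : R -> X) (speed : R -> R) t :
  C1_curve gamma speed -> t \in `[0, 1] -> 0 <= speed t.
Proof. by move=> C1 t01; have [_ [c [_ _ _ ->]]] := C1 t t01. Qed.

(** Reversal changes the sign of the velocity in the chart, and the quadratic form of the metric is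
    even. *)
Lemma C1_curve_reverse (gamma : R -> X) (speed : R -> R) :
  C1_curve gamma speed ->
  C1_curve (fun t => gamma (1 - t)) (fun t => speed (1 - t)).
Proof.
move=> C1 t t01.
have t01' : 1 - t \in `[0, 1].
  by move: t01; rewrite !in_itv/= => /andP[? ?]; apply/andP; split; lra.
have revc : {for t, continuous (fun s : R => 1 - s)}.
  by move=> ?; exact: (@cvgB _ R^o _ _ _ (cst 1) id _ _ (cvg_cst _) cvg_id).
have [gc [c /= [cg dq cq st]]] := C1 _ t01'.
split; first exact: (@continuous_comp _ _ _ (fun s : R => 1 - s) gamma).
set q := phi c \o gamma in dq cq st.
have near_reflection (P : set R) : (\forall u \near 1 - t, P u) ->
    \forall s \near t, P (1 - s) by exact: revc.
have near_rev := near_reflection _ dq.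
pose q' s := q (1 - s).
have q'E s : derivable q (1 - s) 1 ->
    derivable q' s 1 /\ derive1 q' s = - derive1 q (1 - s).
  exact: derive1_reflection.
have [_ q't] := q'E _ (nbhs_singleton near_rev).
exists c; change (phi c \o (fun t => gamma (1 - t))) with q'; split.
- exact: cg.
- by move: near_rev; apply: filterS => s /q'E[].
(* The formula for [derive1 q'] holds only near [t], so the limit is transferred along an eventual
   equality. *)
- have cq' : derive1 q' x @[x --> t] --> derive1 q' t; last exact: cq'.
  rewrite q't.
  have cN : (fun s => - derive1 q (1 - s)) x @[x --> t] --> - derive1 q (1 - t).
    apply: cvgN.
    exact: (@continuous_comp _ _ _ (fun s : R => 1 - s) (derive1 q)).
  apply: cvg_trans cN.
  by apply: near_eq_cvg; move: near_rev; apply: filterS => s /q'E[_ ->].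
- rewrite st; congr (Num.sqrt _).
  rewrite q't.
  by rewrite linearN/= mulNmx mulNmx mulmxN opprK.
Qed.

End curves.

Section line.
Context {R : realType}.

Lemma is_derive_line (V : normedModType R) (u w : V) (s : R) :
  is_derive s (1 : R) (fun s : R => u + s *: w) w.
Proof.
have h : (fun h : R => h^-1 *: ((u + (h *: (1 : R) + s) *: w) - (u + s *: w)))
    @ 0^' --> w.
  apply: cvg_near_cst; near=> h.
  have h0 : h != 0 by near: h; exact: nbhs_dnbhs_neq.
  rewrite opprD addrACA subrr add0r -scalerBl addrK scalerA.
  by rewrite [_ *: 1]mulr1 mulVf// scale1r.
by apply: DeriveDef; [apply/cvg_ex; exists w|exact: cvg_lim].
Unshelve. all: by end_near. Qed.

End line.

(** * Symmetry and triangle inequality of the geodesic distance *)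

Section distance.
Context {R : realType} {X : riemannianManifold R}.
Local Open Scope ereal_scope.

Lemma piecewise_C1_length_ge0 (x y : X) l : piecewise_C1_length x y l -> 0 <= l.
Proof.
elim=> // gamma speed z l' C1 _ l'0; apply: adde_ge0 => //.
by apply: integral_ge0 => t t01; rewrite lee_fin; exact: C1_speed_ge0 C1 _.
Qed.

Lemma piecewise_C1_length_cat (x y z : X) l l' :
  piecewise_C1_length x y l -> piecewise_C1_length y z l' ->
  piecewise_C1_length x z (l + l').
Proof.
move=> xy; elim: xy z l' => [y'|gamma speed y' m C1 _ IH] z l' yz.
  by rewrite add0e.
by rewrite -addeA; apply: pw_cons => //; exact: IH.
Qed.

(** The reversed first piece is appended to the reversed tail. An inequality between lengths is
    enough, since the distance is an infimum and the end points can be exchanged. *)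
Lemma piecewise_C1_length_reverse (x y : X) l : piecewise_C1_length x y l ->
  exists2 l', piecewise_C1_length y x l' & l' <= l.
Proof.
elim=> [z|gamma speed z m C1 _ [l' zl' l'm]].
  by exists 0 => //; exact: pw_nil.
have := pw_cons (C1_curve_reverse C1) (pw_nil _).
rewrite subr0 subrr => rev.
exists (l' +
  (\int[lebesgue_measure]_(t in `[0%R, 1%R]) (speed (1 - t)%R)%:E + 0)).
  exact: piecewise_C1_length_cat zl' rev.
rewrite adde0 addeC leeD//.
apply: (@ge0_integral_reflection_le R (fun t => (speed t)%:E)) => t t01.
by rewrite lee_fin; exact: C1_speed_ge0 C1 _.
Qed.

Lemma dist_ge0 (x y : X) : 0 <= dist x y.
Proof. by apply: le_ereal_inf_tmp => l; exact: piecewise_C1_length_ge0. Qed.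

Lemma dist_sym_le (x y : X) : dist x y <= dist y x.
Proof.
apply: le_ereal_inf_tmp => l /piecewise_C1_length_reverse[l' xy l'l].
by apply: le_trans l'l; exact: ereal_inf_lbound.
Qed.

Lemma dist_sym (x y : X) : dist x y = dist y x.
Proof. by apply/eqP; rewrite eq_le !dist_sym_le. Qed.

Lemma dist_triangle (y x z : X) : dist x z <= dist x y + dist y z.
Proof.
(* Infinite values make the bound trivial; once they are excluded, subtraction allows the two infima
   to be handled one after the other. *)
have [yzoo|yzoo] := eqVneq (dist y z) +oo.
  by rewrite yzoo addey ?leey// -ltNye (lt_le_trans _ (dist_ge0 _ _)).
have yzfin : dist y z \is a fin_num.
  by rewrite ge0_fin_numE ?dist_ge0// ltey.
rewrite -leeBlDr//; apply: le_ereal_inf_tmp => l xy.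
have [->|loo] := eqVneq l +oo; first by rewrite leey.
have lfin : l \is a fin_num.
  by rewrite ge0_fin_numE ?ltey// (piecewise_C1_length_ge0 xy).
rewrite leeBlDr// -leeBlDl//; apply: le_ereal_inf_tmp => l' yz.
rewrite leeBlDl//; apply: ereal_inf_lbound.
exact: piecewise_C1_length_cat xy yz.
Qed.

End distance.

(** * Points close in the topology are close in geodesic distance *)

Section short_segments.
Context {R : realType} {X : riemannianManifold R}.

(** The norm of a matrix is its largest absolute entry, so each of the [n ^ 2] terms is bounded
    separately. *)
Lemma quadratic_form_le n (v : 'rV[R]_n) (G : 'M[R]_n) :
  ((v *m G *m v^T) 0 0 <= n%:R ^+ 2 * `|G| * `|v| ^+ 2).
Proof.
have nm m k (B : 'M[R]_(m, k)) i j : `|B i j| <= `|B|.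
  by rewrite [leRHS]mx_normrE (le_trans _ (le_bigmax _ _ (i, j))).
rewrite mxE (le_trans (ler_norm _))// (le_trans (ler_norm_sum _ _ _))//.
apply: (@le_trans _ _ (\sum_(j < n) \sum_(i < n) `|v| * `|G| * `|v|)).
  apply: ler_sum => j _; rewrite !mxE normrM.
  rewrite (le_trans (ler_wpM2r _ (ler_norm_sum _ _ _)))// mulr_suml.
  by apply: ler_sum => i _; rewrite normrM ler_pM ?mulr_ge0 ?ler_pM.
by rewrite !sumr_const card_ord -mulrnA -[leLHS]mulr_natl natrM; nra.
Qed.

(* A straight segment in a chart is a short curve. *)
Lemma dist_near (x : X) (e : R) : 0 < e ->
  \forall y \near x, (dist x y <= e%:E)%E.
Proof.
move=> e0; have [c cx] := chart_at x.
have /nbhs_normP[r0 /= r00 r0U] : \forall v \near phi c x, (phi c @` dom c) v.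
  by apply: open_nbhs_nbhs; split; [exact: open_image_dom|exact: imageP].
set u := phi c x in r0U.
pose n := Defs.dim X.
pose K := `|metric c u| + 1.
have [r1 /= r10 r1G] : exists2 r1, 0 < r1 &
    forall v, `|u - v| < r1 -> `|metric c v| <= K.
  have /nbhs_normP[d /= d0 dG] :=
    metric_continuous cx (nbhsx_ballx (metric c u) 1 ltr01).
  exists d => // v /dG; rewrite /= -ball_normE/= => /ltW Guv.
  by rewrite -[metric c v](subrK (metric c u)) (le_trans (ler_normD _ _))//
    addrC lerD2l distrC.
(* Since [1 <= N], both [n%:R ^+ 2 * K] and [N] are at most [N ^+ 2]; taking square roots, the speed
   of the segment is at most [N] times the norm of [w]. *)
pose N := 1 + n%:R ^+ 2 * K.
have K0 : 0 <= K by rewrite addr_ge0.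
have N1 : 1 <= N by rewrite lerDl mulr_ge0// exprn_ge0.
have N0 : 0 < N by exact: lt_le_trans N1.
(* The half keeps the segment in the chart for all parameters of modulus below 2, because
   differentiability is needed on a neighbourhood of each point of [0, 1]; [e / N] makes the speed
   at most [e]. *)
pose r := Num.min (Num.min r0 r1 / 2) (e / N).
have r_gt0 : 0 < r by rewrite !lt_min !divr_gt0// lt_min r00 r10.
have : \forall y \near x, dom c y /\ `|u - phi c y| < r.
  near=> y; split; near: y.
    by apply: open_nbhs_nbhs; split; [exact: open_dom|].
  have : nbhs x (phi c @^-1` ball u r).
    exact: (phi_continuous cx (nbhsx_ballx u r r_gt0)).
  by apply: filterS => y; rewrite /= -ball_normE.
apply: filterS => y [cy uy].
pose w := phi c y - u.
have wr : `|w| < r by rewrite /w distrC.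
have [wr01 wrN] : 2 * `|w| < Num.min r0 r1 /\ N * `|w| <= e.
  move: wr; rewrite lt_min ltr_pdivlMr// ltr_pdivlMr// ![(`|w| * _)]mulrC.
  by move=> /andP[? /ltW].
pose line t : 'rV[R]_(Defs.dim X) := u + t *: w.
have line_near t : `|t| < 2 -> `|u - line t| < Num.min r0 r1.
  move=> t2; rewrite /line opprD addrA subrr add0r normrN normrZ.
  by apply: le_lt_trans wr01; rewrite ler_wpM2r// ltW.
have line_dom t : `|t| < 2 -> exists2 x', dom c x' & phi c x' = line t.
  by move=> /line_near; rewrite lt_min => /andP[+ _] => /r0U[x']; exists x'.
pose gamma t : X := phi_inv c (line t).
have gammaE t : `|t| < 2 -> phi c (gamma t) = line t.
  by move=> /line_dom[x' cx' xt]; rewrite /gamma -xt phiK.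
have near2 (t : R) : `|t| < 2 -> \forall s \near t, `|s| < 2.
  move=> t2; apply: (@open_nbhs_nbhs _ t [set s : R | (`|s| < 2)]); split => //.
  rewrite (_ : [set _ | _] = ball (0 : R) 2); first exact: ball_open.
  by apply/seteqP; split => s; rewrite -ball_normE/= sub0r normrN.
have q_near t : `|t| < 2 -> \forall s \near t, line s = (phi c \o gamma) s.
  by move=> /near2; apply: filterS => s /gammaE.
have q_is_derive t : `|t| < 2 -> is_derive t (1 : R) (phi c \o gamma) w.
  by move=> /q_near; move/near_eq_is_derive; apply; exact: is_derive_line.
have q_derive t : `|t| < 2 -> derive1 (phi c \o gamma) t = w.
  by move=> /q_is_derive dq; rewrite derive1E; case: dq.
pose speed t := Num.sqrt ((w *m metric c (line t) *m w^T) 0 0).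
have t012 (t : R) : t \in `[0, 1] -> `|t| < 2.
  by rewrite in_itv/= => /andP[t0 t1]; rewrite ger0_norm//; lra.
have C1 : C1_curve gamma speed.
  move=> t /t012 t2; have [x' cx' xt] := line_dom t t2; split.
    apply: (@continuous_comp _ _ _ line (phi_inv c)).
      have : derivable line t 1 by case: (is_derive_line u w t).
      by move=> /derivable1_diffP; exact: differentiable_continuous.
    by rewrite -xt; exact: phi_inv_continuous.
  exists c => /=; split.
  - by rewrite /gamma -xt phiK.
  - by move: (near2 t t2); apply: filterS => s /q_is_derive[].
  - suff cw : derive1 (phi c \o gamma) s @[s --> t] --> w.
      by move: cw; rewrite -[in X in _ --> X -> _](q_derive t t2).
    apply: cvg_near_cst; move: (near2 t t2); apply: filterS => s.
    exact: q_derive.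
  - by rewrite q_derive// gammaE.
have := pw_cons C1 (pw_nil _).
have -> : gamma 0 = x by rewrite /gamma /line scale0r addr0 phiK.
have -> : gamma 1 = y by rewrite /gamma /line scale1r /w addrC subrK phiK.
rewrite adde0 => xy.
apply: (le_trans (ereal_inf_lbound xy)).
apply: (@le_trans _ _ (\int[lebesgue_measure]_(t in `[0%R, 1%R]) cst e%:E t)%E).
  apply: ge0_le_integral_nonmeasurable => t /= t01;
    rewrite lee_fin ?sqrtr_ge0//.
  apply: le_trans wrN.
  have wN0 : 0 <= N * `|w| by rewrite mulr_ge0// ltW.
  rewrite -[leRHS]ger0_norm// -sqrtr_sqr; apply: ler_wsqrtr.
  apply: (le_trans (quadratic_form_le _ _)); rewrite exprMn ler_wpM2r//.
  apply: (@le_trans _ _ (n%:R ^+ 2 * K)).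
    rewrite ler_wpM2l ?exprn_ge0//; apply: r1G.
    by have := line_near t (t012 t t01); rewrite lt_min => /andP[].
  apply: (@le_trans _ _ N); first by rewrite lerDr.
  by rewrite expr2 ler_peMr// ltW.
rewrite integral_cst//= lebesgue_measure_itv/= lte_fin ltr01.
by rewrite oppr0 adde0 mule1.
Unshelve. all: by end_near. Qed.

End short_segments.

(** * Moments *)

Section moments.
Context {R : realType} {X : riemannianManifold R}.
Local Open Scope ereal_scope.

(** Strict sublevel sets are open, by the triangle inequality and [dist_near], and the rays
    unbounded below generate the measurable sets of [\bar R]. *)
Lemma measurable_dist (x0 : X) :
  measurable_fun setT (dist x0 : borel X -> \bar R).
Proof.
apply: (measurability _ (ErealGenInftyO.measurableE R)) => _ [_ [r ->] <-].
rewrite setTI; apply: sub_sigma_algebra; rewrite openE => x /=.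
rewrite in_itv/= => x0x; rewrite /interior.
have xfin : dist x0 x \is a fin_num.
  by rewrite ge0_fin_numE ?dist_ge0// (lt_trans x0x)// ltry.
have e0 : (0 < (r - fine (dist x0 x)) / 2)%R.
  by rewrite divr_gt0// subr_gt0 -lte_fin fineK.
have := dist_near x e0; apply: filterS => y xy /=; rewrite in_itv/=.
apply: (le_lt_trans (dist_triangle x x0 y)).
apply: (le_lt_trans (leeD2l _ xy)).
by rewrite -(fineK xfin) -EFinD lte_fin; move: e0; lra.
Qed.

(** The sum is at most twice the maximum, and the power of the maximum is one of the two powers.
    This crude constant works for every positive [p]. *)
Lemma poweRD_le (p : R) (a b : \bar R) : (0 < p)%R -> 0 <= a -> 0 <= b ->
  (a + b) `^ p <= (2 `^ p)%:E * (a `^ p + b `^ p).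
Proof.
move=> p0 a0 b0.
have m0 : 0 <= maxe a b by rewrite le_max a0.
have lepow (x y : \bar R) : 0 <= x -> x <= y -> x `^ p <= y `^ p.
  move=> x0 xy; apply: gt0_ler_poweR => //; first exact: ltW.
    by rewrite in_itv/= x0 leey.
  by rewrite in_itv/= (le_trans x0 xy) leey.
apply: (@le_trans _ _ ((2%:E * maxe a b) `^ p)).
  apply: lepow; first exact: adde_ge0.
  rewrite (_ : 2%:E = 1 + 1)// ge0_muleDl// !mul1e.
  by apply: leeD; rewrite le_max lexx ?orbT.
rewrite poweRM// poweR_EFin; apply: lee_wpmul2l.
  by rewrite lee_fin powR_ge0.
by rewrite /maxe; case: ifP => _; rewrite ?leeDl ?leeDr ?poweR_ge0.
Qed.

(** No optimal coupling is needed: a finite infimum provides some coupling of finite cost, against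
    which the triangle inequality through the second point is integrated. *)
Lemma moment_wasserstein (p : R) (mu nu : probability (borel X) R) (x0 : X) :
  (0 < p)%R -> wasserstein p mu nu < +oo ->
  \int[nu]_x (dist x0 x `^ p) < +oo -> \int[mu]_x (dist x0 x `^ p) < +oo.
Proof.
move=> p0 Woo nuoo.
have [g gmunu goo] : exists2 g, coupling mu nu g &
    \int[g]_z (dist (z.1 : X) (z.2 : X) `^ p) < +oo.
  have /lty_poweRy : (p^-1 != 0)%R by rewrite invr_neq0// gt_eqF.
  by move=> /(_ _ Woo)/ereal_inf_lt[_ [g gc <-] goo]; exists g.
pose d2 (z : borel X * borel X) := dist x0 (z.2 : X) `^ p.
pose d12 (z : borel X * borel X) := dist (z.1 : X) (z.2 : X) `^ p.
have mpow : measurable_fun setT (fun x : borel X => dist x0 (x : X) `^ p).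
  exact: (measurableT_comp (measurable_poweR p) (measurable_dist x0)).
pose K := (2 `^ p)%R.
have K0 : (0 < K)%R by exact: powR_gt0.
(* Dividing by [K] on the side of [mu], where the integrand is measurable,
   avoids scaling the integral of [d12], which is not known to be measurable. *)
pose f (x : borel X) := (K^-1)%:E * dist x0 (x : X) `^ p.
have f0 x : 0 <= f x by rewrite mule_ge0 ?poweR_ge0// lee_fin invr_ge0 ltW.
have mu_le : \int[mu]_x f x <= \int[g]_z f z.1.
  apply: (@ge0_le_integral_pushforward _ _ _ (borel X * borel X)%type (borel X)
    fst g mu f) => // A mA.
  have [gA _] := gmunu A mA; apply/esym.
  rewrite (_ : fst @^-1` A = A `*` setT); first exact: gA.
  by apply/seteqP; split => [[? ?]|[? ?] []].
have nu_eq : \int[g]_z d2 z = \int[nu]_x (dist x0 x `^ p).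
  rewrite -[LHS](@ge0_integral_pushforward _ _ (borel X * borel X)%type
    (borel X) R snd measurable_snd g setT (fun x => dist x0 (x : X) `^ p))//;
    last by move=> x _; exact: poweR_ge0.
  apply: eq_measure_integral => A mA _; have [_ gA] := gmunu A mA.
  apply: etrans gA; rewrite /= /pushforward; congr (g _).
  by apply/seteqP; split => [[? ?]|[? ?] []].
have md2 : measurable_fun setT d2 := measurableT_comp mpow measurable_snd.
have d2oo : \int[g]_z d2 z < +oo by rewrite nu_eq.
have f_le z : f z.1 <= d2 z + d12 z.
  rewrite /f lee_pdivrMl//.
  apply: le_trans (poweRD_le p0 (dist_ge0 _ _) (dist_ge0 _ _)).
  apply: gt0_ler_poweR; first exact: ltW.
  - by rewrite in_itv/= dist_ge0 leey.
  - by rewrite in_itv/= adde_ge0 ?dist_ge0 ?leey.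
  - by rewrite [dist z.1 z.2]dist_sym; exact: dist_triangle.
have foo : \int[mu]_x f x < +oo.
  apply: (le_lt_trans mu_le).
  apply: (@le_lt_trans _ _ (\int[g]_z (d2 z + d12 z))).
    exact: ge0_le_integral_nonmeasurable.
  (* Subadditivity asks for measurability of the first summand only, here the distance to the fixed
     point [x0]. *)
  apply: (@le_lt_trans _ _ (\int[g]_z d2 z + \int[g]_z d12 z)).
    by apply: ge0_integralD_le => // z; exact: poweR_ge0.
  exact: lte_add_pinfty.
move: foo; rewrite /f ge0_integralZl//; last 2 first.
- by move=> x _; exact: poweR_ge0.
- by rewrite lee_fin invr_ge0 ltW.
rewrite !ltey; apply: contra => /eqP ->.
by rewrite gt0_muley// lte_fin invr_gt0.
Qed.

End moments.

(** * Contraction of CAVI *)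

Section root_limit.
Context {R : realType}.

Lemma limn_esup_le_near (u : nat -> \bar R) (l : \bar R) :
  (\forall m \near \oo, (u m <= l)%E) -> (limn_esup u <= l)%E.
Proof.
move=> ul; rewrite /limn_esup limf_esupE.
apply: (@le_trans _ _ (ereal_sup [set u m | m in [set m | (u m <= l)%E]])).
  by apply: ereal_inf_lbound; exists [set m | (u m <= l)%E].
by apply: ge_ereal_sup => _ [m /= um <-].
Qed.

(** With [r] strictly between [rho] and [r'], the constant [K] is absorbed by the powers of
    [r / r'], which tend to 0; hence eventually [u m <= r' ^+ m]. *)
Lemma limn_esup_root_le (u : nat -> R) (rho : R) : 0 <= rho ->
  (forall m, 0 <= u m) ->
  (forall r, rho < r -> exists K, forall m, u m <= K * r ^+ m) ->
  (limn_esup (fun m => (u m `^ m%:R^-1)%:E) <= rho%:E)%E.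
Proof.
move=> rho0 u0 ub; apply/lee_addgt0Pr => e e0; rewrite -EFinD.
set r' := rho + e; have r'0 : 0 < r' by rewrite /r'; lra.
pose r := rho + e / 2.
have r0 : 0 < r by rewrite /r; lra.
have [K uK] : exists K, forall m, u m <= K * r ^+ m.
  by apply: ub; rewrite /r; lra.
apply: limn_esup_le_near.
have rr1 : `|r / r'| < 1.
  rewrite ger0_norm ?divr_ge0 ?ltW// ltr_pdivrMr// mul1r /r /r'; lra.
have : \forall m \near \oo, geometric K (r / r') m < 1.
  by apply: (cvgr_lt 0 (cvg_geometric K rr1)); exact: ltr01.
move=> near1; near=> m.
(* At [m = 0] the inverse is 0 by convention, and the root would not undo the power. *)
have m0 : (0 < m)%N by near: m; exists 1%N.
have um : u m <= r' ^+ m.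
  apply: (le_trans (uK m)).
  have : geometric K (r / r') m < 1 by near: m.
  rewrite /geometric/= exprMn exprVn mulrA ltr_pdivrMr ?exprn_gt0// mul1r.
  exact: ltW.
rewrite lee_fin.
apply: (@le_trans _ _ ((r' ^+ m) `^ m%:R^-1)).
  by apply: ge0_ler_powR; rewrite ?nnegrE ?invr_ge0// exprn_ge0// ltW.
rewrite -powR_mulrn ?(ltW r'0)// -powRrM divff ?powRr1 ?(ltW r'0)//.
by rewrite pnatr_eq0 -lt0n.
Unshelve. all: by end_near. Qed.

Lemma spectral_radius_ge0 n (A : 'M[R]_n) : 0 <= spectral_radius A.
Proof.
have [[z Az]|noeig] := pselect (exists z, eigenvalue
    (map_mx (fun x : R => x%:C%C) A) z).
  apply: le_trans (spectral_radius_ge Az).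
  by case: (z) => a b; exact: sqrtr_ge0.
(* Without eigenvalues the supremum is over the empty set, whose conventional value is 0. *)
rewrite /spectral_radius [X in sup X](_ : _ = set0) ?sup0//.
by apply/seteqP; split => // _ [z /= Az _]; apply: noeig; exists z.
Qed.

End root_limit.

(** * One update of a single factor *)

Section contraction.
Context {R : realType} {M : nat} {X : 'I_M -> riemannianManifold R}.
Local Open Scope ereal_scope.

Lemma wasserstein_ge0 (Y : riemannianManifold R) p
    (mu nu : probability (borel Y) R) : 0 <= wasserstein p mu nu.
Proof. exact: poweR_ge0. Qed.

Lemma fisher_info_dominates (Y : riemannianManifold R)
    (mu nu : probability (borel Y) R) : fisher_info mu nu < +oo -> mu `<< nu.
Proof. by rewrite /fisher_info; case: pselect => // _; rewrite ltxx. Qed.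

Variables (p : R) (f : Xprod X -> R) (mustar : prob_family X).
Variables (eps : 'I_M -> \bar R) (L : 'I_M -> 'I_M -> R) (lambda : 'I_M -> R).
Variable (i : 'I_M).
Hypothesis hstar : is_optimality_map f mustar (mustar i).
Hypothesis hL : fisher_smooth p f mustar eps L i.
Hypothesis hlambda : transport_information p (lambda i) (mustar i).
Variables (mu : prob_family X) (nu : probability (borel (X i)) R).
Hypothesis hmu : forall j, j != i -> wball p (eps j) (mustar j) (mu j).
Hypothesis hmuoo : forall j, j != i -> wasserstein p (mu j) (mustar j) < +oo.
Hypothesis hnu : is_optimality_map f mu nu.

(** By the fixed-point property, [mustar i] is itself the value of the map at [mustar], so
    Fisher-smoothness compares [nu] with it. *)
Lemma optimality_map_fisher_le : fisher_info nu (mustar i) <=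
  (\sum_(j | j != i) (L i j)%:E * wasserstein p (mu j) (mustar j)) ^+ 2.
Proof. exact: hL.2 hmu _ _ hnu hstar. Qed.

Let fisher_bound_ge0 :
  0 <= \sum_(j | j != i) (L i j)%:E * wasserstein p (mu j) (mustar j).
Proof.
apply: sume_ge0 => j ji; apply: mule_ge0; last exact: wasserstein_ge0.
by rewrite lee_fin; exact: hL.1.
Qed.

Lemma optimality_map_dominates : nu `<< mustar i.
Proof.
apply: fisher_info_dominates; apply: (le_lt_trans optimality_map_fisher_le).
rewrite expe2; apply: lte_mul_pinfty => //.
  rewrite ge0_fin_numE//; apply: lte_sum_pinfty => j ji.
  by rewrite lte_mul_pinfty ?lee_fin ?hL.1// hmuoo.
apply: lte_sum_pinfty => j ji.
by rewrite lte_mul_pinfty ?lee_fin ?hL.1// hmuoo.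
Qed.

Lemma optimality_map_contraction : wasserstein p nu (mustar i) <=
  \sum_(j | j != i) (L i j / lambda i)%:E * wasserstein p (mu j) (mustar j).
Proof.
have [l0 _ /(_ nu optimality_map_dominates) lW] := hlambda.
have := le_trans lW optimality_map_fisher_le.
(* Both sides become squares, and the square root may be taken because the right-hand base is
   nonnegative. *)
have -> : (lambda i ^+ 2)%:E * wasserstein p nu (mustar i) ^+ 2 =
    ((lambda i)%:E * wasserstein p nu (mustar i)) ^+ 2.
  by rewrite !expe2 muleACA -EFinM expr2.
move/(lee_sqrE fisher_bound_ge0); rewrite -lee_pdivlMl// => /le_trans; apply.
rewrite ge0_sume_distrr; last first.
  move=> j ji; apply: mule_ge0; last exact: wasserstein_ge0.
  by rewrite lee_fin; exact: hL.1.
by apply: lee_sum => j ji; rewrite muleA -EFinM [(_^-1 * _)%R]mulrC.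
Qed.

End contraction.

(** * Iteration inside the balls and the asymptotic rate *)

Section cavi_convergence.
Context {R : realType} {M : nat} {X : 'I_M -> riemannianManifold R}.
Variables (p : R) (f : Xprod X -> R) (mustar : prob_family X).
Variables (eps : 'I_M -> \bar R) (L : 'I_M -> 'I_M -> R) (lambda : 'I_M -> R).
Variables (A : 'M[R]_M) (delta : 'cV[R]_M) (c : R).
Hypothesis p0 : 0 < p.
Hypothesis hstar : forall i, is_optimality_map f mustar (mustar i).
Hypothesis hstar_p : forall i, Pp_manifold p (mustar i).
Hypothesis hL : forall i, fisher_smooth p f mustar eps L i.
Hypothesis hlambda : forall i, transport_information p (lambda i) (mustar i).
Hypothesis hA : A = \matrix_(i, j) (if i == j then 0 else L i j / lambda i).
Hypothesis hAdelta : forall i, (A *m delta) i 0 < delta i 0.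
Hypothesis c0 : 0 < c.
Hypothesis hceps : forall i, ((c * delta i 0)%:E <= eps i)%E.

Local Notation in_balls mu :=
  (forall i, wball p (c * delta i 0)%:E (mustar i) (mu i)).
Local Notation W mu i := (wasserstein p (mu i) (mustar i)).

Let A_ge0 i j : 0 <= A i j.
Proof.
rewrite hA mxE; case: eqVneq => // ij; have [l0 _ _] := hlambda i.
by rewrite divr_ge0 ?(ltW l0)//; apply: (hL i).1; rewrite eq_sym.
Qed.

Let W_lty mu i : in_balls mu -> (W mu i < +oo)%E.
Proof. by move=> /(_ i)[_ /lt_trans]; apply; exact: ltry. Qed.

Let W_fineK mu i : in_balls mu -> (fine (W mu i))%:E = W mu i.
Proof.
by move=> mub; rewrite fineK// ge0_fin_numE ?W_lty//; exact: poweR_ge0.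
Qed.

Lemma cavi_step_le mu mu' : in_balls mu -> cavi_step f mu mu' ->
  forall i, (W mu' i <= \sum_j (A i j)%:E * W mu j)%E.
Proof.
(* The zero diagonal of [A] removes the term [j = i]. *)
move=> mub mumu' i; rewrite (bigD1 i)//= {1}hA mxE eqxx mul0e add0e.
have mueps j : j != i -> wball p (eps j) (mustar j) (mu j).
  by move=> _; have [Pmu Wmu] := mub j; split; rewrite ?(lt_le_trans Wmu).
have Woo j : j != i -> (W mu j < +oo)%E by move=> _; exact: W_lty.
apply: (le_trans (optimality_map_contraction (hstar i) (hL i) (hlambda i)
  mueps Woo (mumu' i))).
by apply: lee_sum => j ji; rewrite hA mxE eq_sym (negbTE ji).
Qed.

Lemma cavi_step_in_balls mu mu' : in_balls mu -> cavi_step f mu mu' ->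
  in_balls mu'.
Proof.
move=> mub mumu' i.
have mueps j : j != i -> wball p (eps j) (mustar j) (mu j).
  by move=> _; have [Pmu Wmu] := mub j; split; rewrite ?(lt_le_trans Wmu).
have Woo j : j != i -> (W mu j < +oo)%E by move=> _; exact: W_lty.
have Wlt : (W mu' i < (c * delta i 0)%:E)%E.
  apply: (le_lt_trans (cavi_step_le mub mumu' i)).
  (* The old distances are bounded by [c * delta] non-strictly, as entries of [A] may vanish;
     strictness comes from [hAdelta]. *)
  apply: (@le_lt_trans _ _ (\sum_j (A i j * (c * delta j 0))%:E)%E).
    apply: lee_sum => j _; rewrite EFinM lee_wpmul2l ?lee_fin//.
    by have [_ /ltW] := mub j.
  rewrite sumEFin lte_fin; have : c * (A *m delta) i 0 < c * delta i 0.
    by rewrite ltr_pM2l.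
  apply: le_lt_trans; rewrite mxE mulr_sumr.
  by apply: ler_sum => j _; rewrite mulrCA.
(* Membership in the ball also asks for absolute continuity, which passes through [mustar i], and
   for a finite moment, taken at the base point of [mustar i]. *)
split=> //; have [starvol [x0 starm]] := hstar_p i; split.
  have mac := optimality_map_dominates (hstar i) (hL i) mueps Woo (mumu' i).
  exact: null_dominates_trans mac starvol.
exists x0; apply: moment_wasserstein starm => //.
by apply: lt_trans Wlt _; exact: ltry.
Qed.

Lemma cavi_iter_in_balls (mu : nat -> prob_family X) k :
  in_balls (mu k) -> (forall m, cavi_step f (mu (k + m)%N) (mu (k + m).+1)) ->
  forall m, in_balls (mu (k + m)%N).
Proof.
move=> mub step; elim=> [|m IH]; first by rewrite addn0.
by rewrite addnS; exact: cavi_step_in_balls (step m).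
Qed.

(** All distances are finite inside the balls, so the induction runs over real numbers; since [A]
    has nonnegative entries, multiplying by it preserves the inequalities. *)
Lemma cavi_iter_le (mu : nat -> prob_family X) k :
  in_balls (mu k) -> (forall m, cavi_step f (mu (k + m)%N) (mu (k + m).+1)) ->
  forall m i, fine (W (mu (k + m)%N) i) <=
    \sum_j (A ^+ m) i j * fine (W (mu k) j).
Proof.
move=> mub step; have mukb := cavi_iter_in_balls mub step.
elim=> [|m IH] i.
  rewrite addn0 expr0 (bigD1 i)//= mxE eqxx mul1r lerDl sumr_ge0// => j ji.
  by rewrite mxE eq_sym (negbTE ji) mul0r.
have := cavi_step_le (mukb m) (step m) i.
under eq_bigr do rewrite -W_fineK// -EFinM.
rewrite -addnS -W_fineK// sumEFin lee_fin => /le_trans; apply.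
apply: (@le_trans _ _
    (\sum_j A i j * \sum_l (A ^+ m) j l * fine (W (mu k) l))).
  by apply: ler_sum => j _; rewrite ler_wpM2l.
under eq_bigr do rewrite mulr_sumr.
rewrite exchange_big/=; apply: ler_sum => l _.
rewrite exprS [(A * _) i l]mxE mulr_suml.
by apply: ler_sum => j _; rewrite mulrA.
Qed.

Lemma cavi_iter_lee (mu : nat -> prob_family X) k :
  in_balls (mu k) -> (forall m, cavi_step f (mu (k + m)%N) (mu (k + m).+1)) ->
  forall m i, (W (mu (k + m)%N) i <= \sum_j ((A ^+ m) i j)%:E * W (mu k) j)%E.
Proof.
move=> mub step m i; rewrite -W_fineK//; last exact: cavi_iter_in_balls.
under eq_bigr do rewrite -W_fineK// -EFinM.
by rewrite sumEFin lee_fin; exact: cavi_iter_le.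
Qed.

Lemma cavi_rate (mu : nat -> prob_family X) k :
  in_balls (mu k) -> (forall m, cavi_step f (mu (k + m)%N) (mu (k + m).+1)) ->
  (limn_esup (fun m =>
     (`|\col_i fine (W (mu (k + m)%N) i)| `^ m%:R^-1)%:E)
   <= (spectral_radius A)%:E)%E.
Proof.
move=> mub step; apply: limn_esup_root_le => //.
  exact: spectral_radius_ge0.
move=> r Ar; have [K K0 AK] := mxpow_spectral_bound Ar.
have r0 : 0 <= r by rewrite (le_trans (spectral_radius_ge0 A))// ltW.
have w0 j : 0 <= fine (W (mu k) j) by rewrite fine_ge0// poweR_ge0.
(* The norm of the vector is its largest entry, and each entry of [A ^+ m] is at most
   [K * r ^+ m]. *)
exists (\sum_j K * fine (W (mu k) j)) => m.
rewrite [leLHS]mx_normrE; apply: bigmax_le => [|[i j] _ /=].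
  by rewrite mulr_ge0 ?exprn_ge0// sumr_ge0// => j _; rewrite mulr_ge0.
rewrite mxE ger0_norm; last by rewrite fine_ge0// poweR_ge0.
apply: (le_trans (cavi_iter_le mub step m i)); rewrite mulr_suml.
apply: ler_sum => l _; rewrite mulrAC ler_wpM2r//.
exact: le_trans (ler_norm _) (AK m i l).
Qed.

End cavi_convergence.

Theorem theorem3 (R : realType) (M : nat) (X : 'I_M -> riemannianManifold R)
    (hX : forall i, complete_manifold (X i))
    (p : R) (hp : 1 <= p)
    (f : Xprod X -> R) (hf : measurable_fun setT f)
    (target : probability (Xprod X) R)
    (hpi : forall A, measurable A ->
       target A = (\int[vol_prod X]_(x in A) (expR (- f x))%:E)%E)
    (hpi_p : Pp (vol_prod X) (@dist_prod R M X) p target)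
    (mustar : prob_family X)
    (hstar : forall i, is_optimality_map f mustar (mustar i))
    (hstar_p : forall i, Pp_manifold p (mustar i))
    (eps : 'I_M -> \bar R) (heps : forall i, (0 < eps i)%E)
    (L : 'I_M -> 'I_M -> R)
    (hL : forall i, fisher_smooth p f mustar eps L i)
    (lambda : 'I_M -> R)
    (hlambda : forall i, transport_information p (lambda i) (mustar i))
    (A : 'M[R]_M)
    (hA : A = \matrix_(i, j) (if i == j then 0 else L i j / lambda i))
    (hrho : spectral_radius A < 1)
    (delta : 'cV[R]_M) (hdelta : forall i, 0 < delta i 0)
    (hAdelta : forall i, (A *m delta) i 0 < delta i 0)
    (c : R) (hc : 0 < c) (hceps : forall i, ((c * delta i 0)%:E <= eps i)%E)
    (mu : nat -> prob_family X) (k : nat)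
    (hk : forall i, wball p (c * delta i 0)%:E (mustar i) (mu k i))
    (hstep : cavi_step f (mu k) (mu k.+1)) :
  let W n i : \bar R := wasserstein p (mu n i) (mustar i) in
  [/\ forall i, (W k.+1 i <= \sum_j (A i j)%:E * W k j)%E,
      forall i, wball p (c * delta i 0)%:E (mustar i) (mu k.+1 i) &
      (forall m, cavi_step f (mu (k + m)%N) (mu (k + m).+1)) ->
        (forall m i,
           (W (k + m)%N i <= \sum_j ((A ^+ m) i j)%:E * W k j)%E) /\
        (limn_esup (fun m =>
           (`|\col_i fine (W (k + m)%N i)| `^ (m%:R^-1))%:E)
         <= (spectral_radius A)%:E)%E].
Proof.
move=> W.
have p0 : 0 < p by exact: lt_le_trans hp.
split.
- move=> i; exact: (cavi_step_le hstar hL hlambda hA hceps hk hstep i).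
- exact: (cavi_step_in_balls p0 hstar hstar_p hL hlambda hA hAdelta hc hceps hk
    hstep).
move=> steps; split.
- move=> m i; exact: (cavi_iter_lee p0 hstar hstar_p hL hlambda hA hAdelta hc
    hceps hk steps m i).
- exact: (cavi_rate p0 hstar hstar_p hL hlambda hA hAdelta hc hceps hk steps).
Qed.
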